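(* Let $\beta_b>1$, $d>4\beta_b$, and fix $\kappa>0$ and $v_0>0$. There is $C<\infty$ (not depending on $n$, on $f$, on the design points, or on $t$) such that the following holds for every $t\in(0,1]$, every $n$, every $f$ that is the restriction to $[0,1]^d$ of a function in $\mathcal H^{\beta_b}(L;U)$, and every realized design $X_1,\dots,X_n\in[0,1]^d$. On every cell $Q\in\mathcal Q_n$ satisfying $\lambda_{\min}(G_Q/N_Q)\ge\kappa$ and for every pair $e=(i,j)\subset I_Q$ satisfying $\|U_i-U_j\|_\infty\le t$ and $v_e=d_e^\top R_Qd_e\ge v_0$, $$\left|\frac{d_e^\top R_Qf_Q}{\sqrt{v_e}}\right|\le C\,H_n^{\beta_b}\,t .$$
   Context: **Hölder balls.** Fix an open set $U\subset\mathbb R^d$ containing $[0,1]^d$ and $L\ge1$. For $s>0$ put $\ell_s=\lceil s\rceil-1$, $\alpha_s=s-\ell_s\in(0,1]$, and $\|g\|_{C^s(U)}=\sum_{|\nu|\le\ell_s}\|\partial^\nu g\|_{L^\infty(U)}+\max_{|\nu|=\ell_s}\sup_{x\ne y\in U}\frac{|\partial^\nu g(x)-\partial^\nu g(y)|}{\|x-y\|^{\alpha_s}}$. Let $\mathcal H^s(L;U)=\{g:U\to\mathbb R:\|g\|_{C^s(U)}\le L\}$. **Partition.** Fix $\lambda_0>0$; $r_n=\max\{0,\operatorname{round}(\log_2(n/\lambda_0))\}$, $J_n=2^{r_n}$, $H_n=J_n^{-1/d}$. Choose nonnegative integers $s_{n,1},\dots,s_{n,d}$ with sum $r_n$, pairwise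 differing by at most one; split coordinate $j$ of $[0,1]^d$ into $2^{s_{n,j}}$ equal intervals. The resulting partition $\mathcal Q_n$ has $J_n$ axis-aligned rectangular cells of volume $J_n^{-1}$ (boundaries assigned by a fixed half-open convention); each side length is between fixed positive multiples of $H_n$. Write $\overline Q=b_Q+A_Q[0,1]^d$ with $A_Q$ diagonal, and for $X_i\in Q$ let $U_i=A_Q^{-1}(X_i-b_Q)\in[0,1]^d$. **Cell quantities.** $\ell=\lceil\beta_b\rceil-1$, $q=\binom{d+\ell}{\ell}$; $\psi=(\psi_1,\dots,\psi_q)^\top$ is a fixed basis of polynomials on $\mathbb R^d$ of total degree at most $\ell$. For a cell $Q$: $I_Q=\{i:X_i\in Q\}=\{i_1<\dots<i_{N_Q}\}$, $N_Q=|I_Q|$, $\Phi_Q\in\mathbb R^{N_Q\times q}$ has rows $\psi(U_{i_r})^\top$, $f_Q=(f(X_{i_1}),\dots,f(X_{i_{N_Q}}))^\top$, $G_Q=\Phi_Q^\top\Phi_Q$, and, when $G_Q$ is invertible, $R_Q=I_{N_Q}-\Phi_QG_Q^{-1}\Phi_Q^\top$. For a pair $e=(i,j)$ of distinct indices in $I_Q$ with $i=i_r$, $j=i_s$, $d_e=e_r-e_s\in\mathbb R^{N_Q}$ (difference of standard basis vectors). *)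

(* Defs.v *)
From HB Require Import structures.
From mathcomp Require Import all_boot all_order all_algebra.
(* The notations of mpoly clash with those of mathcomp-analysis. *)
From mathcomp Require Import -(notations) mpoly.
From mathcomp Require Import all_classical all_reals all_analysis.

Set Implicit Arguments.
Unset Strict Implicit.
Unset Printing Implicit Defensive.

Import Order.TTheory GRing.Theory Num.Theory.
Import numFieldNormedType.Exports.

Local Open Scope classical_set_scope.
Local Open Scope ring_scope.

Definition unit_cube (R : realType) (d : nat) : set 'rV[R]_d :=
  [set x | forall j, 0 <= x 0 j <= 1].

(* The library norm `|x| of a row vector is the sup norm. *)
Definition euclid_norm (R : realType) (d : nat) (x : 'rV[R]_d) : R :=
  Num.sqrt (\sum_j x 0 j ^+ 2).

Definition holder_order (R : realType) (s : R) : nat := absz (Num.ceil s - 1).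

Definition holder_exponent (R : realType) (s : R) : R := s - (holder_order s)%:R.

Definition partial (R : realType) (d : nat) (j : 'I_d) (g : 'rV[R]_d -> R) :
    'rV[R]_d -> R :=
  'D_(delta_mx 0 j : 'rV[R]_d) g.

(* C^k on U. Only meant for U open: the (partial) derivatives at the points
   of U then do not depend on the values of g outside U. *)
Fixpoint class_C (R : realType) (d : nat) (U : set 'rV[R]_d) (k : nat)
    (g : 'rV[R]_d -> R) : Prop :=
  match k with
  | 0 => forall x, U x -> {for x, continuous g}
  | k'.+1 => forall j, (forall x, U x -> derivable g x (delta_mx 0 j)) /\
                       class_C U k' (partial j g)
  end.

Definition mpartial (R : realType) (d : nat) (nu : 'I_d -> nat)
    (g : 'rV[R]_d -> R) : 'rV[R]_d -> R :=
  foldr (fun j => iter (nu j) (@partial R d j)) g (enum 'I_d).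

Definition sup_norm (R : realType) (d : nat) (U : set 'rV[R]_d)
    (g : 'rV[R]_d -> R) : \bar R :=
  ereal_sup [set `|g x|%:E | x in U].

Definition holder_seminorm (R : realType) (d : nat) (U : set 'rV[R]_d) (a : R)
    (g : 'rV[R]_d -> R) : \bar R :=
  ereal_sup [set (`|g z.1 - g z.2| / euclid_norm (z.1 - z.2) `^ a)%:E
            | z in [set z : 'rV[R]_d * 'rV[R]_d | [/\ U z.1, U z.2 & z.1 != z.2]]].

(* A multi-index of length at most l has entries at most l, so it is
   represented by a function to 'I_l.+1. *)
Definition holder_norm (R : realType) (d : nat) (U : set 'rV[R]_d) (s : R)
    (g : 'rV[R]_d -> R) : \bar R :=
  let l := holder_order s in
  (\sum_(nu : {ffun 'I_d -> 'I_l.+1} | (\sum_j nu j <= l)%N)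
      sup_norm U (mpartial (fun j => nu j) g) +
   \big[maxe/0%E]_(nu : {ffun 'I_d -> 'I_l.+1} | (\sum_j nu j == l)%N)
      holder_seminorm U (holder_exponent s) (mpartial (fun j => nu j) g))%E.

Definition holder_ball (R : realType) (d : nat) (U : set 'rV[R]_d) (s L : R) :
    set ('rV[R]_d -> R) :=
  [set g | class_C U (holder_order s) g /\ (holder_norm U s g <= L%:E)%E].

(* Any tie-breaking rule is allowed. *)
Definition rounds_to_nearest (R : realType) (rnd : R -> int) : Prop :=
  forall x : R, `|x - (rnd x)%:~R| <= 2^-1.

Definition resolution (R : realType) (rnd : R -> int) (lambda0 : R) (n : nat) :
    nat :=
  absz (Num.max 0 (rnd (ln (n%:R / lambda0) / ln 2))).

Definition cell_number (R : realType) (rnd : R -> int) (lambda0 : R) (n : nat) :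
    nat :=
  2 ^ resolution rnd lambda0 n.

Definition cell_size (R : realType) (d : nat) (rnd : R -> int) (lambda0 : R)
    (n : nat) : R :=
  (cell_number rnd lambda0 n)%:R `^ (- d%:R^-1).

Definition balanced_split (d r : nat) (s : 'I_d -> nat) : Prop :=
  (\sum_j s j)%N = r /\ (forall j k, (s j <= (s k).+1)%N).

(* A cell is identified with its position in the grid. *)
Definition cell_index (d : nat) (s : 'I_d -> nat) : Type :=
  forall j, 'I_(2 ^ s j).

Definition cell_corner (R : realType) (d : nat) (s : 'I_d -> nat)
    (Q : cell_index s) : 'rV[R]_d :=
  \row_j ((Q j)%:R / 2 ^+ s j).

Definition cell_scale (R : realType) (d : nat) (s : 'I_d -> nat) : 'M[R]_d :=
  diag_mx (\row_j (2 ^- s j)).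

Definition cell_coord (R : realType) (d : nat) (s : 'I_d -> nat)
    (Q : cell_index s) (x : 'rV[R]_d) : 'rV[R]_d :=
  (x - cell_corner R Q) *m invmx (cell_scale R s).

(* The half-open convention: coordinate j is split into intervals [a, b[ when
   side j = true and into intervals ]a, b] when side j = false, except that
   0 belongs to the first interval and 1 to the last one. *)
Definition cell_interval (R : realType) (d : nat) (side : 'I_d -> bool)
    (s : 'I_d -> nat) (Q : cell_index s) (j : 'I_d) : interval R :=
  Interval
    (if Q j == 0%N :> nat then BLeft 0
     else BSide (side j) ((Q j)%:R / 2 ^+ s j))
    (if (Q j).+1 == (2 ^ s j)%N then BRight 1
     else BSide (side j) ((Q j).+1%:R / 2 ^+ s j)).

Definition in_cell (R : realType) (d : nat) (side : 'I_d -> bool)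
    (s : 'I_d -> nat) (Q : cell_index s) (x : 'rV[R]_d) : bool :=
  [forall j, x 0 j \in cell_interval R side Q j].

Definition cell_points (R : realType) (d n : nat) (side : 'I_d -> bool)
    (s : 'I_d -> nat) (Q : cell_index s) (X : 'I_n -> 'rV[R]_d) : {set 'I_n} :=
  [set i | in_cell side Q (X i)]%SET.

(* [mmeasure (@mdeg d) p] is the library's [msize p], one more than the total
   degree of p (and 0 for p = 0). *)
Definition poly_basis (R : realType) (d l q : nat) (psi : 'I_q -> mpoly d R) :
    Prop :=
  (forall c, (mmeasure (@mdeg d) (psi c) <= l.+1)%N) /\
  (forall p : mpoly d R, (mmeasure (@mdeg d) p <= l.+1)%N ->
     exists! w : 'rV[R]_q, p = \sum_c w 0 c *: psi c).

(* [enum_val r] is the r-th smallest index in I. *)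
Definition basis_matrix (R : realType) (d q n : nat) (psi : 'I_q -> mpoly d R)
    (I : {set 'I_n}) (u : 'I_n -> 'rV[R]_d) : 'M[R]_(#|I|, q) :=
  \matrix_(r, c) meval (fun j => u (enum_val r) 0 j) (psi c).

Definition gram (R : realType) (N q : nat) (Phi : 'M[R]_(N, q)) : 'M[R]_q :=
  Phi^T *m Phi.

Definition residual_maker (R : realType) (N q : nat) (Phi : 'M[R]_(N, q)) :
    'M[R]_N :=
  1%:M - Phi *m invmx (gram Phi) *m Phi^T.

(* Only used for symmetric matrices, all of whose eigenvalues are real. *)
Definition lambda_min (R : realType) (q : nat) (A : 'M[R]_q) : R :=
  inf [set a | eigenvalue A a].

Definition pair_diff (R : realType) (N : nat) (r s : 'I_N) : 'cV[R]_N :=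
  delta_mx r 0 - delta_mx s 0.

(* Main.v *)
Require Import Defs.
From mathcomp Require Import all_boot all_order all_algebra.
From mathcomp Require Import -(notations) mpoly.
From mathcomp Require Import all_classical all_reals all_analysis.
From mathcomp Require Import ring lra.

Set Implicit Arguments.
Unset Strict Implicit.
Unset Printing Implicit Defensive.

Import Order.TTheory GRing.Theory Num.Theory.
Import numFieldNormedType.Exports.

Local Open Scope classical_set_scope.
Local Open Scope ring_scope.

(** The residual maker kills the column space of the design matrix, which
    contains the values of every polynomial of degree at most l, the Hoelder
    order of beta. Hence the function can be replaced by its remainder rho after
    subtraction of its Taylor polynomial at the corner of the cell
    ([residual_pair_le]).

    The remainder has size H^beta on the cell, and it is moreover Lipschitz in
    the cell coordinates with a constant of the same size, because beta > 1
    leaves at least one derivative to spare ([holder_taylor_box]). The contrast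
    of a close pair is the increment of rho, at most H^beta t, minus the
    increment of the basis functions, at most a constant times t, paired with
    the least-squares coefficients of rho. Those are bounded by a multiple of
    the supremum of |rho|: the eigenvalue hypothesis makes the normalized Gram
    matrix coercive ([lambda_min_rayleigh]), so that the number of points in the
    cell cancels.

    The estimate of the remainder is by downward induction on the order of its
    derivatives ([taylor_rem_le]). All derivatives of order at most l of the
    remainder vanish at the corner; those of order l are controlled by the
    Hoelder condition, and every lower order gains one factor of the size of the
    cell by the mean value theorem along a path parallel to the axes
    ([box_lipschitz]). Iterated derivatives are indexed by the word of
    differentiation directions, since the induction adds a direction in front,
    while the Hoelder norm only sees the words in which the directions are
    sorted; the two are reconciled by the symmetry of mixed derivatives
    ([partial_comm], [wpartial_perm]). *)

(** * Mean value estimates along the axes *)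

Local Notation "''e_' i" := (delta_mx 0 i) (at level 8, i at level 2, format "''e_' i").

Lemma is_derive_line (R : realType) (d : nat) (F : 'rV[R]_d -> R) x (i : 'I_d) t :
  derivable F (x + t *: 'e_i) 'e_i ->
  is_derive t 1 (fun t => F (x + t *: 'e_i)) (partial i F (x + t *: 'e_i)).
Proof.
have E : (fun h : R => h^-1 *: (F (x + (h *: (1 : R) + t) *: 'e_i) - F (x + t *: 'e_i))) =
   (fun h : R => h^-1 *: (F (h *: 'e_i + (x + t *: 'e_i)) - F (x + t *: 'e_i))).
  apply/funext => h; congr (_ *: (F _ - _)).
  by rewrite scalerDl [h *: 1]mulr1 addrCA.
move=> dF; apply: DeriveDef; first by rewrite /derivable /= E.
by rewrite /partial /derive /= E.
Qed.

(** The interval is written with [min] and [max] so that [h] may have either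
    sign. *)
Lemma axis_mvt (R : realType) (d : nat) (F : 'rV[R]_d -> R) x (i : 'I_d) h :
  (forall t, Num.min 0 h <= t <= Num.max 0 h ->
    derivable F (x + t *: 'e_i) 'e_i) ->
  exists2 t, Num.min 0 h <= t <= Num.max 0 h &
    F (x + h *: 'e_i) - F x = partial i F (x + t *: 'e_i) * h.
Proof.
move=> dF.
pose phi t := F (x + t *: 'e_i); pose dphi t := partial i F (x + t *: 'e_i).
have cphi : {within `[Num.min 0 h, Num.max 0 h], continuous phi}.
  apply: derivable_within_continuous => t; rewrite in_itv /= => /dF Ft.
  by have := is_derive_line Ft => -[].
have [|t|t] := @MVT_segment R phi dphi (Num.min 0 h) (Num.max 0 h) _ _ cphi.
- by rewrite ge_min !le_max !lexx.
- by rewrite in_itv/= => /andP[/ltW ? /ltW ?]; apply/is_derive_line/dF/andP.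
rewrite in_itv /= => tI; rewrite /phi /dphi => E; exists t => //.
case: (leP 0 h) E => h0; rewrite scale0r addr0 ?subr0// => /eqP.
by rewrite sub0r mulrN -eqr_oppLR opprB => /eqP.
Qed.

(** Moving the coordinates one after the other keeps the path inside the box,
    so the partial derivatives there control the whole increment. *)
Lemma box_lipschitz (R : realType) (d : nat) (F : 'rV[R]_d -> R) (a b : 'rV[R]_d)
    (M : R) :
  (forall z : 'rV[R]_d, (forall j, a 0 j <= z 0 j <= b 0 j) ->
     forall i, derivable F z 'e_i /\ `|partial i F z| <= M) ->
  forall x y : 'rV[R]_d, (forall j, a 0 j <= x 0 j <= b 0 j) ->
     (forall j, a 0 j <= y 0 j <= b 0 j) ->
  `|F x - F y| <= M * \sum_j `|x 0 j - y 0 j|.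
Proof.
move=> HF x y xB yB.
(* The path from y to x: after k steps, the first k coordinates are those of x. *)
pose z k : 'rV[R]_d := \row_j (if (j < k)%N then x 0 j else y 0 j).
have zB k j : a 0 j <= z k 0 j <= b 0 j by rewrite mxE; case: ifP.
have step k (kd : (k < d)%N) : let i := Ordinal kd in
    `|F (z k.+1) - F (z k)| <= M * `|x 0 i - y 0 i|.
  move=> i.
  have zi : z k.+1 = z k + (x 0 i - y 0 i) *: 'e_i.
    apply/rowP => j; rewrite !mxE eqxx /=; case: (eqVneq j i) => [->|ji].
      by rewrite /= ltnSn ltnn mulr1 addrC subrK.
    rewrite ltnS leq_eqVlt mulr0 addr0; case: eqP => //= jk; case/eqP: ji.
    exact: val_inj.
  have path t : Num.min 0 (x 0 i - y 0 i) <= t <= Num.max 0 (x 0 i - y 0 i) ->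
     forall j, a 0 j <= (z k + t *: 'e_i) 0 j <= b 0 j.
    move=> tI j; rewrite !mxE eqxx /=; case: (eqVneq j i) => [->|ji].
      rewrite /= ltnn mulr1; move: (xB i) (yB i) tI.
      by case: (leP 0 (x 0 i - y 0 i)) => _; lra.
    by rewrite mulr0 addr0; move: (zB k j); rewrite mxE.
  have [t tI E] := axis_mvt (fun t tI => (HF _ (path t tI) i).1).
  rewrite zi E normrM ler_wpM2r//; exact: (HF _ (path t tI) i).2.
have main k : (k <= d)%N ->
   `|F (z k) - F (z 0%N)| <= M * \sum_(j < d | (j < k)%N) `|x 0 j - y 0 j|.
  elim: k => [_|k IH kd]; first by rewrite subrr normr0 big_pred0 ?mulr0.
  have -> : F (z k.+1) - F (z 0%N) = (F (z k.+1) - F (z k)) + (F (z k) - F (z 0%N)).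
    by ring.
  apply: le_trans (ler_normD _ _) _.
  rewrite (bigD1 (Ordinal kd)) /= ?ltnSn// mulrDr lerD ?step//.
  apply: le_trans (IH (ltnW kd)) _; rewrite (eq_bigl (fun i : 'I_d => (i < k)%N))// => i.
  by rewrite ltnS -val_eqE /= [(i < k)%N]ltn_neqAle andbC.
have zx : z d = x by apply/rowP => j; rewrite mxE ltn_ord.
have zy : z 0%N = y by apply/rowP => j; rewrite mxE.
have := main d (leqnn d); rewrite zx zy; congr (_ <= _ * _).
by apply: eq_bigl => j; rewrite ltn_ord.
Qed.

(** * Symmetry of mixed partial derivatives *)

Lemma coord_le_norm (R : realType) d (v : 'rV[R]_d) j : `|v 0 j| <= `|v|.
Proof. by rewrite [`|v|]mx_normrE (le_bigmax _ _ (0, j)). Qed.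

Lemma norm_le_coord (R : realType) d (v : 'rV[R]_d) r :
  0 <= r -> (forall j, `|v 0 j| <= r) -> `|v| <= r.
Proof.
move=> r0 vr; rewrite [`|v|]mx_normrE; apply: bigmax_le => // -[i j] _ /=.
by rewrite ord1.
Qed.

Lemma near_box (R : realType) d (x : 'rV[R]_d) (P : set 'rV[R]_d) :
  nbhs x P ->
  exists2 r : R, 0 < r & forall y : 'rV[R]_d, (forall j, `|y 0 j - x 0 j| <= r) -> P y.
Proof.
move=> /nbhs_ballP[e /= e0 eP]; exists (e / 2); first by rewrite divr_gt0.
move=> y yx; apply: eP; rewrite -ball_normE /= distrC.
apply: (@le_lt_trans _ _ (e / 2)); last by rewrite ltr_pdivrMr// ltr_pMr// ltr1n.
by apply: norm_le_coord => [|j]; [rewrite divr_ge0// ltW | rewrite !mxE].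
Qed.

(** Continuous, hence locally bounded, partial derivatives make a function
    locally Lipschitz; so all the derivatives below the top order are
    continuous as well. *)
Lemma class_C_continuous (R : realType) d (U : set 'rV[R]_d) k g x :
  open U -> class_C U k g -> U x -> {for x, continuous g}.
Proof.
move=> oU; elim: k g => [|k IH] g /= gC Ux; first exact: gC.
pose M := \sum_j (`|partial j g x| + 1).
have M0 : 0 <= M by apply: sumr_ge0 => j _; rewrite addr_ge0.
have nearM : \forall y \near x, forall j, U y /\ `|partial j g y| <= M.
  suff H j : nbhs x [set y | U y /\ `|partial j g y| <= M].
    exact: (filter_forall (nbhs_filter x) H).
  apply: filterI; first exact: open_nbhs_nbhs.
  have /cvgrPdist_le /(_ 1 ltr01) := IH _ (gC j).2 Ux.
  apply: filterS => y yx; rewrite /M (bigD1 j) //=.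
  apply: ler_wpDr; first by apply: sumr_ge0 => i _; rewrite addr_ge0.
  rewrite -lerBlDl; apply: le_trans yx; rewrite distrC; exact: lerB_dist.
have [r r0 rP] := near_box nearM.
pose a : 'rV[R]_d := x - const_mx r; pose b : 'rV[R]_d := x + const_mx r.
have box (y : 'rV[R]_d) :
    (forall j, a 0 j <= y 0 j <= b 0 j) <-> (forall j, `|y 0 j - x 0 j| <= r).
  by split=> H j; move: (H j); rewrite !mxE ler_norml; lra.
have lip (y : 'rV[R]_d) : (forall j, `|y 0 j - x 0 j| <= r) ->
    `|g x - g y| <= M * \sum_j `|x 0 j - y 0 j|.
  move=> yB; apply: (@box_lipschitz _ _ _ a b).
  - move=> z /box zB i; have [Uz zM] := rP _ zB i.
    by split=> //; exact: (gC i).1.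
  - by apply/box => j; rewrite subrr normr0 ltW.
  - exact/box.
apply/(@cvgrPdist_le _ _ _ _ (nbhs_filter x)) => e e0.
have e'0 : 0 < e / (M * d%:R + 1).
  by rewrite divr_gt0 // ltr_wpDl // mulr_ge0.
have m0 : 0 < Num.min r (e / (M * d%:R + 1)) by rewrite lt_min r0.
apply: (@filterS _ _ (nbhs_filter x) _ _ _ (nbhsx_ballx x _ m0)) => y.
rewrite -ball_normE => /ltW yx.
move: yx; rewrite le_min => /andP[yr ye].
have yc j : `|x 0 j - y 0 j| <= `|x - y|.
  by have := coord_le_norm (x - y) j; rewrite !mxE.
apply: le_trans (lip _ _) _ => [j|].
  by rewrite distrC (le_trans (yc j)).
apply: (@le_trans _ _ (M * (d%:R * `|x - y|))).
  rewrite ler_wpM2l // mulr_natl -[X in _ *+ X]card_ord -sumr_const.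
  by apply: ler_sum => j _.
move: ye; rewrite ler_pdivlMr ?ltr_wpDl ?mulr_ge0// => ye.
apply: le_trans ye; rewrite mulrA mulrC ler_wpM2l//; lra.
Qed.

Lemma is_derive_translate (R : realType) d (F : 'rV[R]_d -> R) c y v :
  derivable F (y + c) v ->
  is_derive y v (fun y => F (y + c)) ('D_v F (y + c)).
Proof.
have E : (fun h : R => h^-1 *: (F (h *: v + y + c) - F (y + c))) =
         (fun h : R => h^-1 *: (F (h *: v + (y + c)) - F (y + c))).
  by apply/funext => h; rewrite addrA.
move=> dF; apply: DeriveDef; first by rewrite /derivable /= E.
by rewrite /derive /= E.
Qed.

(** The mean value theorem used once in each direction. The left-hand side is
    symmetric in [i] and [j]: this is why mixed derivatives commute. *)
Lemma mixed_difference (R : realType) d (F : 'rV[R]_d -> R) (x : 'rV[R]_d) i j (s : R) :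
  0 < s -> i != j ->
  (forall z : 'rV[R]_d, (forall k, `|z 0 k - x 0 k| <= s) ->
     derivable F z 'e_i /\ derivable (partial i F) z 'e_j) ->
  exists2 z : 'rV[R]_d, (forall k, `|z 0 k - x 0 k| <= s) &
    F (x + s *: 'e_i + s *: 'e_j) - F (x + s *: 'e_i) - F (x + s *: 'e_j) + F x =
    partial j (partial i F) z * s * s.
Proof.
move=> s0 ij HF; have ms : Num.min 0 s = 0 by apply/min_idPl/ltW.
have Ms : Num.max 0 s = s by apply/max_idPr/ltW.
have Bz t t' : 0 <= t <= s -> 0 <= t' <= s ->
    forall k, `|(x + t *: 'e_i + t' *: 'e_j) 0 k - x 0 k| <= s.
  move=> tI tI' k; rewrite !mxE eqxx /= ler_norml.
  case: (eqVneq k i) => [->|ki]; first by rewrite (negbTE ij) /= mulr1 mulr0; lra.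
  by case: (k == j); rewrite /= ?mulr1 ?mulr0; lra.
pose G y := F (y + s *: 'e_j) - F y.
have sI : 0 <= s <= s by rewrite (ltW s0) lexx.
have zI : 0 <= (0 : R) <= s by rewrite lexx ltW.
have dG t : 0 <= t <= s -> is_derive (x + t *: 'e_i) 'e_i G
    (partial i F (x + t *: 'e_i + s *: 'e_j) - partial i F (x + t *: 'e_i)).
  move=> tI; apply: is_deriveB.
    by apply: is_derive_translate; exact: (HF _ (Bz t s tI sI)).1.
  apply: DeriveDef => //.
  by have := (HF _ (Bz t 0 tI zI)).1; rewrite scale0r addr0.
have [|t] := @axis_mvt _ _ G x i s; rewrite ?ms ?Ms.
  by move=> t /dG [].
move=> tI; rewrite /partial (@derive_val _ _ _ _ _ _ _ (dG t tI)) => EG.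
have [|t'] := @axis_mvt _ _ (partial i F) (x + t *: 'e_i) j s; rewrite ?ms ?Ms.
  by move=> t' tI'; exact: (HF _ (Bz t t' tI tI')).2.
move=> tI' EF; exists (x + t *: 'e_i + t' *: 'e_j); first exact: Bz.
by rewrite -EF -EG /G; ring.
Qed.

(** Divided by the area of the square, the second difference is a value near [x]
    of either mixed derivative; both are continuous. *)
Lemma partial_comm (R : realType) d (U : set 'rV[R]_d) (F : 'rV[R]_d -> R) i j x :
  open U -> class_C U 2 F -> U x ->
  partial i (partial j F) x = partial j (partial i F) x.
Proof.
move=> oU FC Ux; have [->//|ij] := eqVneq i j.
have Fij := ((FC j).2 i).2 _ Ux.
have Fji := ((FC i).2 j).2 _ Ux.
apply/eqP; rewrite -subr_eq0 -normr_le0; apply/ler_addgt0Pl => e e0.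
rewrite addr0; have e20 : 0 < e / 2 by rewrite divr_gt0.
move/cvgrPdist_le/(_ _ e20): Fij => Fij; move/cvgrPdist_le/(_ _ e20): Fji => Fji.
have Unear : nbhs x U by exact: open_nbhs_nbhs.
have [s s0 sP] := near_box (filterI Unear (filterI Fij Fji)).
have [|z zB E] := @mixed_difference _ _ F x i j s s0 ij.
  by move=> z /sP[Uz _]; split; [exact: (FC i).1|exact: ((FC i).2 j).1].
have [||z' zB' E'] := @mixed_difference _ _ F x j i s s0.
- by rewrite eq_sym.
- by move=> z' /sP[Uz _]; split; [exact: (FC j).1|exact: ((FC j).2 i).1].
have EE : partial j (partial i F) z = partial i (partial j F) z'.
  have ss : s * s != 0 by rewrite mulf_neq0// gt_eqF.
  apply: (mulIf ss); rewrite !mulrA -E -E'; congr (_ + _).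
  by rewrite [RHS]addrAC [x + _ + _]addrAC.
have [_ [_ zP]] := sP _ zB; have [_ [zP' _]] := sP _ zB'.
rewrite (splitr e); apply: le_trans (lerD zP' zP); rewrite EE.
rewrite [X in _ <= _ + X]distrC; apply: le_trans (ler_normD _ _).
by rewrite addrA subrK.
Qed.

(** * Iterated partial derivatives *)

(** The last letter of the word is the first derivative to be taken, so that a
    further derivative is a letter in front. *)
Definition wpartial (R : realType) d (g : 'rV[R]_d -> R) (w : seq 'I_d) :=
  foldr (@partial R d) g w.

(** Not immediate from the recursion, which asks for continuity at the top order
    only. *)
Lemma class_C_leq (R : realType) d (U : set 'rV[R]_d) k l g :
  open U -> (l <= k)%N -> class_C U k g -> class_C U l g.
Proof.
move=> oU; elim: l k g => [|l IH] k g lk gC.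
  by move=> x; exact: class_C_continuous gC.
case: k lk gC => // k lk gC j; split; first exact: (gC j).1.
exact: IH lk (gC j).2.
Qed.

Lemma class_C_wpartial (R : realType) d (U : set 'rV[R]_d) w k g :
  class_C U (size w + k)%N g -> class_C U k (wpartial g w).
Proof.
elim: w k => [//|j w IH] k; rewrite [size _]/= addSnnS => /IH gC.
exact: (gC j).2.
Qed.

Lemma wpartial_derivable (R : realType) d (U : set 'rV[R]_d) k g w j x :
  open U -> class_C U k g -> (size w < k)%N -> U x -> derivable (wpartial g w) x 'e_j.
Proof.
move=> oU gC wk Ux.
have gw : class_C U 1 (wpartial g w).
  by apply: class_C_wpartial; apply: class_C_leq gC; rewrite ?addn1.
exact: (gw j).1.
Qed.

Lemma partial_local (R : realType) d (U : set 'rV[R]_d) f g j x :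
  open U -> (forall y, U y -> f y = g y) -> U x -> partial j f x = partial j g x.
Proof.
move=> oU fg Ux; apply: near_eq_derive.
by apply: (@filterS _ _ (nbhs_filter x) U) => //; exact: open_nbhs_nbhs.
Qed.

Lemma wpartial_shift (R : realType) d (U : set 'rV[R]_d) k g i w1 w2 x :
  open U -> class_C U k g -> (size (i :: w1 ++ w2) <= k)%N -> U x ->
  wpartial g (i :: w1 ++ w2) x = wpartial g (w1 ++ i :: w2) x.
Proof.
move=> oU gC; elim: w1 x => [//|j w1 IH] x; rewrite [size _]/= => wk Ux.
rewrite [LHS](@partial_comm _ _ U)//; last first.
  by apply: (@class_C_wpartial _ _ U (w1 ++ w2)); apply: class_C_leq gC; rewrite ?addn2.
by apply: (@partial_local _ _ U) => // y; apply: IH; exact: ltnW.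
Qed.

(** Equality holds on [U] only; it survives a further derivative because [U] is
    open. *)
Lemma wpartial_perm (R : realType) d (U : set 'rV[R]_d) k g w w' x :
  open U -> class_C U k g -> (size w <= k)%N -> perm_eq w w' -> U x ->
  wpartial g w x = wpartial g w' x.
Proof.
move=> oU gC; elim: w w' x => [|i w IH] w' x wk ww' Ux.
  by have -> : w' = [::] by apply/perm_nilP; rewrite perm_sym.
have : i \in w' by rewrite -(perm_mem ww') mem_head.
move=> iw'; case/splitPr: iw' ww' => w1 w2 ww'.
have ww2 : perm_eq w (w1 ++ w2).
  by rewrite -(perm_cons i) (permPl ww') -(cat1s i w2) perm_catCA.
rewrite -(@wpartial_shift _ _ U k)//; last first.
  by rewrite [size _]/= -(perm_size ww2).
by apply: (@partial_local _ _ U) => // y; apply: IH => //; exact: ltnW.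
Qed.

(** The order in which [mpartial] takes the derivatives. *)
Definition multi_word d (nu : 'I_d -> nat) : seq 'I_d :=
  flatten [seq nseq (nu i) i | i <- enum 'I_d].

Lemma mpartial_word (R : realType) d (nu : 'I_d -> nat) (g : 'rV[R]_d -> R) :
  mpartial nu g = wpartial g (multi_word nu).
Proof.
rewrite /mpartial /multi_word /wpartial; elim: (enum _) => //= i s ->.
by rewrite foldr_cat; elim: (nu i) => //= k ->.
Qed.

Lemma count_multi_word d (nu : 'I_d -> nat) i : count_mem i (multi_word nu) = nu i.
Proof.
rewrite /multi_word count_flatten sumnE !big_map -/(index_enum _) (bigD1 i)//=.
rewrite count_nseq /= eqxx mul1n big1 ?addn0// => j /negbTE ji.
by rewrite count_nseq /= ji.
Qed.

Lemma perm_multi_word d (w : seq 'I_d) :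
  perm_eq w (multi_word (fun i => count_mem i w)).
Proof. by apply/allP => i _ /=; rewrite count_multi_word. Qed.

Lemma size_multi_word d (nu : 'I_d -> nat) : size (multi_word nu) = (\sum_j nu j)%N.
Proof.
rewrite /multi_word size_flatten /shape sumnE !big_map -/(index_enum _).
by apply: eq_bigr => i _; rewrite size_nseq.
Qed.

Lemma sum_count d (w : seq 'I_d) : (\sum_j count_mem j w)%N = size w.
Proof. by rewrite (perm_size (perm_multi_word w)) size_multi_word. Qed.

(** * Polynomial functions and the Taylor polynomial *)

(** The polynomial function whose expansion at [b] has the coefficients of [p]. *)
Definition centered_eval (R : realType) d (b : 'rV[R]_d) (p : mpoly d R)
    (x : 'rV[R]_d) : R :=
  meval (fun i => x 0 i - b 0 i) p.

Lemma is_derive_coord (R : realType) d (b x : 'rV[R]_d) (i j : 'I_d) :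
  is_derive x 'e_i (fun x : 'rV[R]_d => x 0 j - b 0 j) (j == i)%:R.
Proof.
have H : (fun h : R => h^-1 *: (((h *: 'e_i + x) 0 j - b 0 j) - (x 0 j - b 0 j)))
    @ 0^' --> ((j == i)%:R : R).
  apply: cvg_near_cst; near=> h; rewrite !mxE eqxx /=.
  have h0 : h != 0 by near: h; exact: nbhs_dnbhs_neq.
  rewrite -[LHS]/(h^-1 * _).
  have -> : h * (j == i)%:R + x 0 j - b 0 j - (x 0 j - b 0 j) = h * (j == i)%:R.
    by ring.
  by rewrite mulKf.
apply: DeriveDef; first by apply/cvg_ex; exists (j == i)%:R.
exact/cvg_lim.
Unshelve. all: by end_near. Qed.

Lemma is_derive_centered_eval (R : realType) d (b : 'rV[R]_d) (p : mpoly d R) x i :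
  is_derive x 'e_i (centered_eval b p) (centered_eval b (mderiv i p) x).
Proof.
pose good (p : mpoly d R) := forall i : 'I_d,
  is_derive x 'e_i (centered_eval b p) (centered_eval b (mderiv i p) x).
have good1 : good 1.
  move=> k; rewrite (_ : centered_eval b 1 = cst 1); last first.
    by apply/funext => y; rewrite /centered_eval meval1.
  rewrite -mpolyC1 mderivC /centered_eval meval0; exact: is_derive_cst.
have goodM q r : good q -> good r -> good (q * r).
  move=> Gq Gr k.
  have -> : centered_eval b (q * r) = centered_eval b q * centered_eval b r.
    by apply/funext => y; rewrite /centered_eval mevalM.
  apply: (is_derive_eq (is_deriveM (Gq k) (Gr k))).
  rewrite mderivM /centered_eval mevalD !mevalM addrC -![_ *: _]/(_ * _).
  by congr (_ + _); rewrite mulrC.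
have goodU j : good (mpolyX R (mnm1 j)).
  move=> k; rewrite (_ : centered_eval b _ = fun y => y 0 j - b 0 j); last first.
    by apply/funext => y; rewrite /centered_eval mevalXU.
  have -> : centered_eval b (mderiv k (mpolyX R (mnm1 j))) x = (j == k)%:R.
    rewrite mderivX mnm1E /centered_eval mevalZ.
    case: eqVneq => [->|]; last by rewrite mul0r.
    rewrite (_ : mnm_sub _ _ = mnm0) ?mpolyX0 ?meval1 ?mul1r//.
    by apply/mnmP => l; rewrite mnmBE subnn mnm0E.
  exact: is_derive_coord.
have goodX m : good (mpolyX R m).
  rewrite mpolyXE_id; elim/big_ind: _ => // j _.
  elim: (m j) => [|n IH]; first by rewrite expr0.
  by rewrite exprS; apply: goodM.
suff : good p by [].
elim/mpolyind: p => [|c m p _ _ IH] k.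
  rewrite (_ : centered_eval b 0 = cst 0); last first.
    by apply/funext => y; rewrite /centered_eval meval0.
  rewrite mderiv0 /centered_eval meval0; exact: is_derive_cst.
rewrite (_ : centered_eval b _ =
    c *: centered_eval b (mpolyX R m) + centered_eval b p); last first.
  by apply/funext => y; rewrite /centered_eval mevalD mevalZ.
apply: (is_derive_eq (is_deriveD (is_deriveZ c (goodX m k)) (IH k))).
by rewrite mderivD mderivZ /centered_eval mevalD mevalZ.
Qed.

Lemma partial_centered_eval (R : realType) d (b : 'rV[R]_d) (p : mpoly d R) i :
  partial i (centered_eval b p) = centered_eval b (mderiv i p).
Proof.
apply/funext => x.
exact: (@derive_val _ _ _ _ _ _ _ (is_derive_centered_eval b p x i)).
Qed.

Lemma eq_multi_word d (nu1 nu2 : 'I_d -> nat) :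
  nu1 =1 nu2 -> multi_word nu1 = multi_word nu2.
Proof. by move=> E; congr flatten; apply: eq_map => i; rewrite E. Qed.

Lemma foldr_mderiv d (R : realType) (p : mpoly d R) (w : seq 'I_d) :
  foldr (@mderiv d R) p w =
  mderivm (Multinom [tuple count_mem i w | i < d]) p.
Proof.
rewrite mderivm_foldr; apply: mderiv_perm.
rewrite -/(multi_word _) (@eq_multi_word _ _ (fun i => count_mem i w)).
  exact: perm_multi_word.
by move=> i; rewrite mnmE.
Qed.

Lemma centered_eval_center (R : realType) d (b : 'rV[R]_d) (p : mpoly d R) :
  centered_eval b p b = mcoeff mnm0 p.
Proof.
rewrite /centered_eval; elim/mpolyind: p => [|c m p _ _ IH].
  by rewrite meval0 mcoeff0.
rewrite mevalD mevalZ IH mcoeffD mcoeffZ mcoeffX; congr (c * _ + _).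
rewrite mevalX; have [->|m0] := eqVneq m mnm0.
  by rewrite big1// => i _; rewrite mnm0E expr0.
have /existsP[i mi] : [exists i, m i != 0%N].
  apply: contraNT m0 => /existsPn H; apply/eqP/mnmP => i.
  by rewrite mnm0E; apply/eqP; move: (H i); rewrite negbK.
by rewrite (bigD1 i)//= subrr expr0n (negbTE mi) mul0r.
Qed.

Definition taylor (R : realType) d l (g : 'rV[R]_d -> R) (b : 'rV[R]_d) : mpoly d R :=
  \sum_(m : bmultinom d l.+1)
     (wpartial g (multi_word m) b / (\prod_i (m i)`!)%N%:R) *: mpolyX R m.

Lemma taylor_size (R : realType) d l (g : 'rV[R]_d -> R) b :
  (mmeasure (@mdeg d) (taylor l g b) <= l.+1)%N.
Proof.
rewrite /taylor; apply: leq_trans (mmeasure_sum _ _ _ _) _.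
apply/bigmax_leqP => m _; apply: leq_trans (mmeasureZ_le _ _ _) _.
by rewrite mmeasureX bmdeg.
Qed.

Lemma mdeg_count d (w : seq 'I_d) :
  mdeg (Multinom [tuple count_mem i w | i < d]) = size w.
Proof. by rewrite mdegE -sum_count; apply: eq_bigr => i _; rewrite mnmE. Qed.

(** Formal differentiation picks one coefficient, and the factorial it produces
    cancels the one in the definition of [taylor]. The coefficient comes from the
    sorted word; symmetry of the derivatives gives the other words. *)
Lemma taylor_center (R : realType) d (U : set 'rV[R]_d) l g b w :
  open U -> class_C U l g -> U b -> (size w <= l)%N ->
  centered_eval b (foldr (@mderiv d R) (taylor l g b) w) b = wpartial g w b.
Proof.
move=> oU gC Ub wl; rewrite centered_eval_center foldr_mderiv mcoeff_mderivm.
pose coef (m : multinom d) := wpartial g (multi_word m) b / (\prod_i (m i)`!)%N%:R.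
rewrite addm0 (mcoeff_mpoly coef) /coef; last by rewrite mdeg_count.
rewrite (@eq_multi_word _ _ (fun i => count_mem i w)); last first.
  by move=> i; rewrite mnmE.
rewrite -(wpartial_perm oU gC wl (perm_multi_word w) Ub).
under [X in _ *+ X]eq_bigr do rewrite ffactnn.
rewrite -[LHS]mulr_natr divfK// pnatr_eq0 -lt0n prodn_gt0// => i.
exact: fact_gt0.
Qed.

Lemma taylor_top_order (R : realType) d l g (b x : 'rV[R]_d) w :
  size w = l ->
  centered_eval b (foldr (@mderiv d R) (taylor l g b) w) x =
  centered_eval b (foldr (@mderiv d R) (taylor l g b) w) b.
Proof.
move=> wl; set p := foldr _ _ _.
rewrite (_ : p = mpolyC d (mcoeff mnm0 p)) /centered_eval ?mevalC//.
apply/mpolyP => m; rewrite mcoeffC; have [->|m0] := eqVneq m mnm0; first by rewrite mulr1.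
rewrite mulr0 /p foldr_mderiv mcoeff_mderivm memN_msupp_eq0 ?mul0rn//.
apply: mmeasure_mnm_ge; apply: leq_trans (taylor_size _ _ _) _.
by rewrite /= mdegD mdeg_count wl -addn1 leq_add2l lt0n mdeg_eq0.
Qed.

(** * The Taylor remainder *)

(** The polynomial is differentiated formally; by [partial_centered_eval] this is
    the derivative along [w] of the remainder itself. *)
Definition taylor_rem (R : realType) d l (g : 'rV[R]_d -> R) (b : 'rV[R]_d) w x : R :=
  wpartial g w x - centered_eval b (foldr (@mderiv d R) (taylor l g b) w) x.

Lemma taylor_rem_derive (R : realType) d (U : set 'rV[R]_d) l g b w j x :
  open U -> class_C U l g -> (size w < l)%N -> U x ->
  is_derive x 'e_j (taylor_rem l g b w) (taylor_rem l g b (j :: w) x).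
Proof.
move=> oU gC wl Ux; apply: is_deriveB.
  by apply: DeriveDef => //; exact: wpartial_derivable gC wl Ux.
exact: is_derive_centered_eval.
Qed.

(** Here the bound on the first derivatives turns into the factor that is small
    for close points. *)
Lemma taylor_rem_lipschitz (R : realType) d (U : set 'rV[R]_d) l g
    (b c : 'rV[R]_d) (M : R) w :
  open U -> class_C U l g ->
  (forall x : 'rV[R]_d, (forall j, b 0 j <= x 0 j <= c 0 j) -> U x) ->
  (size w < l)%N ->
  (forall j (x : 'rV[R]_d), (forall k, b 0 k <= x 0 k <= c 0 k) ->
     `|taylor_rem l g b (j :: w) x| <= M) ->
  forall x y : 'rV[R]_d, (forall j, b 0 j <= x 0 j <= c 0 j) ->
    (forall j, b 0 j <= y 0 j <= c 0 j) ->
    `|taylor_rem l g b w x - taylor_rem l g b w y| <= M * \sum_j `|x 0 j - y 0 j|.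
Proof.
move=> oU gC BU wl HM x y; apply: box_lipschitz => z zB i.
have D := taylor_rem_derive b i oU gC wl (BU z zB).
split; first by case: D.
by rewrite /partial (@derive_val _ _ _ _ _ _ _ D); exact: HM.
Qed.

(** All derivatives of the remainder vanish at [b], so integrating from [b]
    gains one factor [d * h] for each derivative removed. *)
Lemma taylor_rem_le (R : realType) d (U : set 'rV[R]_d) l g (b c : 'rV[R]_d) (h M : R) :
  0 <= h -> 0 <= M -> open U -> class_C U l g ->
  (forall x : 'rV[R]_d, (forall j, b 0 j <= x 0 j <= c 0 j) -> U x) ->
  (forall j, b 0 j <= c 0 j <= b 0 j + h) ->
  (forall w (x : 'rV[R]_d), size w = l -> (forall j, b 0 j <= x 0 j <= c 0 j) ->
     `|wpartial g w x - wpartial g w b| <= M) ->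
  forall k w (x : 'rV[R]_d), (size w + k)%N = l -> (forall j, b 0 j <= x 0 j <= c 0 j) ->
     `|taylor_rem l g b w x| <= (d%:R * h) ^+ k * M.
Proof.
move=> h0 M0 oU gC BU bch gM.
have bB j : b 0 j <= b 0 j <= c 0 j by have := bch j; lra.
have Ub : U b by exact: BU.
elim=> [|k IH] w x wl xB.
  rewrite addn0 in wl; rewrite expr0 mul1r /taylor_rem (taylor_top_order _ _ _ wl).
  by rewrite (taylor_center oU gC Ub) ?wl//; exact: gM.
have rem0 : taylor_rem l g b w b = 0.
  by rewrite /taylor_rem (taylor_center oU gC Ub) ?subrr// -wl leq_addr.
rewrite -[taylor_rem _ _ _ _ _]subr0 -rem0.
have IHk j (z : 'rV[R]_d) : (forall k, b 0 k <= z 0 k <= c 0 k) ->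
    `|taylor_rem l g b (j :: w) z| <= (d%:R * h) ^+ k * M.
  by apply: IH; rewrite [size _]/= addSnnS.
have wl' : (size w < l)%N by rewrite -wl addnS ltnS leq_addr.
apply: le_trans (taylor_rem_lipschitz oU gC BU wl' IHk xB bB) _.
rewrite exprS -[X in _ <= X]mulrA [X in _ <= X]mulrC ler_wpM2l//.
  by rewrite mulr_ge0// exprn_ge0// mulr_ge0.
rewrite mulr_natl -[X in _ *+ X]card_ord -sumr_const; apply: ler_sum => j _.
by have := bch j; have := xB j; rewrite ler_norml; lra.
Qed.

(** * Hoelder balls *)

(** The norm only contains the sorted derivatives; the bound passes to an
    arbitrary word of top length by symmetry. *)
Lemma holder_ball_wpartial (R : realType) d (U : set 'rV[R]_d) (s L : R) g w x y :
  open U -> 0 <= L -> holder_ball U s L g -> size w = holder_order s ->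
  U x -> U y ->
  `|wpartial g w x - wpartial g w y| <=
    L * euclid_norm (x - y) `^ holder_exponent s.
Proof.
move=> oU L0 [gC gL] wl Ux Uy.
have [->|xy] := eqVneq x y; first by rewrite subrr normr0 mulr_ge0// powR_ge0.
pose nu : {ffun 'I_d -> 'I_(holder_order s).+1} := [ffun i => inord (count_mem i w)].
have nuE i : nu i = count_mem i w :> nat.
  by rewrite ffunE inordK// ltnS; apply: leq_trans (count_size _ _) _; rewrite wl.
have nul : (\sum_j nu j)%N == holder_order s.
  apply/eqP/(etrans _ (etrans (sum_count w) wl)); apply: eq_bigr => i _; exact: nuE.
have E z : U z -> mpartial (fun j => nu j) g z = wpartial g w z.
  move=> Uz; rewrite mpartial_word (eq_multi_word (nu2 := fun i => count_mem i w))//.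
  by apply/esym/(wpartial_perm oU gC _ (perm_multi_word w) Uz); rewrite wl.
pose semi (nu : {ffun 'I_d -> 'I_(holder_order s).+1}) :=
  holder_seminorm U (holder_exponent s) (mpartial (fun j => nu j) g).
have semi_le : (semi nu <= L%:E)%E.
  apply: le_trans gL; rewrite /holder_norm.
  apply: (@le_trans _ _ (\big[maxe/0%E]_(nu : {ffun 'I_d -> 'I_(holder_order s).+1} |
       (\sum_j nu j == holder_order s)%N) semi nu)).
    exact: (le_bigmax_cond _ semi).
  (* The suprema are nonnegative because U contains x. *)
  rewrite leeDr//; apply: sume_ge0 => m _.
  apply: le_trans (_ : `|mpartial (fun j => m j) g x|%:E <= _)%E.
    by rewrite lee_fin.
  by apply: ereal_sup_ubound; exists x.
have nxy : 0 < euclid_norm (x - y).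
  have [i xyi] : exists i, x 0 i != y 0 i.
    apply/existsP; apply: contraNT xy => /existsPn H; apply/eqP/rowP => i.
    by apply/eqP; move: (H i); rewrite negbK.
  rewrite sqrtr_gt0 (bigD1 i)//= ltr_wpDr//.
    by apply: sumr_ge0 => j _; rewrite sqr_ge0.
  by rewrite exprn_even_gt0//= !mxE subr_eq0.
rewrite -ler_pdivrMr ?powR_gt0// -!E// -lee_fin; apply: le_trans semi_le.
by apply: ereal_sup_ubound; exists (x, y).
Qed.

Lemma euclid_norm_le (R : realType) d (v : 'rV[R]_d) h :
  0 <= h -> (forall j, `|v 0 j| <= h) -> euclid_norm v <= d%:R * h.
Proof.
move=> h0 vh; have dh : 0 <= d%:R * h by rewrite mulr_ge0.
rewrite -(ger0_norm dh) -sqrtr_sqr ler_wsqrtr//.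
apply: (@le_trans _ _ (d%:R * h ^+ 2)).
  rewrite mulr_natl -[X in _ *+ X]card_ord -sumr_const; apply: ler_sum => j _.
  by rewrite -[v 0 j ^+ 2]real_normK ?num_real// lerXn2r ?nnegrE.
rewrite exprMn ler_wpM2r ?sqr_ge0// expr2 -natrM ler_nat.
by case: d {v vh dh} => // d; rewrite leq_pmulr.
Qed.

Lemma holder_order_gt0 (R : realType) (beta : R) :
  1 < beta -> (0 < holder_order beta)%N /\ 0 < holder_exponent beta.
Proof.
move=> b1; have c1 : 1 < Num.ceil beta by rewrite ceil_gt_int.
rewrite /holder_exponent /holder_order; split; first by rewrite absz_gt0 subr_eq0 gt_eqF.
rewrite natr_absz ger0_norm ?subr_ge0 ?ltW// subr_gt0; exact: ceilB1_lt.
Qed.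

(** With one factor [d * h] per derivative, the order [l] and the exponent
    [beta - l] of the Hoelder condition add up to the power [beta]. Increments
    stop one derivative earlier and get the last factor from the distance of
    the points. *)
Lemma holder_taylor_box (R : realType) d (U : set 'rV[R]_d) (beta L h : R) g
    (b c : 'rV[R]_d) :
  1 < beta -> 0 <= L -> 0 <= h -> open U -> holder_ball U beta L g ->
  (forall x : 'rV[R]_d, (forall j, b 0 j <= x 0 j <= c 0 j) -> U x) ->
  (forall j, b 0 j <= c 0 j <= b 0 j + h) ->
  let M := L * (d%:R * h) `^ beta in
  let rem := taylor_rem (holder_order beta) g b [::] in
  (forall x : 'rV[R]_d, (forall j, b 0 j <= x 0 j <= c 0 j) -> `|rem x| <= M) /\
  (forall (t : R) (x y : 'rV[R]_d), (forall j, b 0 j <= x 0 j <= c 0 j) ->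
     (forall j, b 0 j <= y 0 j <= c 0 j) -> (forall j, `|x 0 j - y 0 j| <= h * t) ->
     `|rem x - rem y| <= M * t).
Proof.
move=> b1 L0 h0 oU gH BU bch M rem; have gC := gH.1.
have [l0 al0] := holder_order_gt0 b1.
set l := holder_order beta in gC l0 rem *.
pose M0 := L * (d%:R * h) `^ holder_exponent beta.
have dh0 : 0 <= d%:R * h by rewrite mulr_ge0.
have M00 : 0 <= M0 by rewrite mulr_ge0// powR_ge0.
have bB j : b 0 j <= b 0 j <= c 0 j by have := bch j; lra.
have ME : M = (d%:R * h) ^+ l * M0.
  rewrite /M /M0 mulrCA -powR_mulrn// -powRD; last first.
    by rewrite subrKC; apply/implyP; rewrite gt_eqF// (lt_trans _ b1).
  by rewrite subrKC.
have top w (x : 'rV[R]_d) : size w = l -> (forall j, b 0 j <= x 0 j <= c 0 j) ->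
    `|wpartial g w x - wpartial g w b| <= M0.
  move=> wl xB; apply: le_trans (holder_ball_wpartial oU L0 gH wl (BU _ xB) (BU _ bB)) _.
  apply: ler_wpM2l => //; apply: ge0_ler_powR; rewrite ?nnegrE ?sqrtr_ge0 ?(ltW al0)//.
  apply: euclid_norm_le => // j; rewrite !mxE ler_norml.
  by have := xB j; have := bch j; lra.
have remle := taylor_rem_le h0 M00 oU gC BU bch top.
split=> [x xB|t x y xB yB xy]; first by rewrite ME; exact: remle.
have first j (z : 'rV[R]_d) : (forall k, b 0 k <= z 0 k <= c 0 k) ->
    `|taylor_rem l g b [:: j] z| <= (d%:R * h) ^+ l.-1 * M0.
  by apply: remle; rewrite add1n prednK.
apply: le_trans (taylor_rem_lipschitz oU gC BU _ first xB yB) _; first exact: l0.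
have -> : M * t = (d%:R * h) ^+ l.-1 * M0 * (d%:R * h * t).
  by rewrite ME -{1}(prednK l0) exprSr; ring.
apply: ler_wpM2l; first by rewrite mulr_ge0// exprn_ge0.
rewrite -mulrA mulr_natl -[X in _ *+ X]card_ord -sumr_const; apply: ler_sum => j _.
exact: xy.
Qed.

(** * Coercivity of the Gram matrix and the residual contrast *)

Lemma quad_continuous (R : realType) q (A : 'M[R]_q) :
  continuous (fun x : 'rV[R]_q => (x *m A *m x^T) 0 0).
Proof.
have -> : (fun x : 'rV[R]_q => (x *m A *m x^T) 0 0) =
  (fun x : 'rV[R]_q => \sum_i (\sum_j x 0 j * A j i) * x 0 i).
  apply/funext => y; rewrite mxE; apply: eq_bigr => i _; rewrite !mxE; congr (_ * _).
have C (j : 'I_q) : continuous (fun x : 'rV[R]_q => x 0 j) by exact: coord_continuous.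
apply: continuous_big; first exact: add_continuous.
move=> i _ x; apply: (@cvgM _ _ _ (nbhs_filter x)); last exact: C.
move: x; apply: continuous_big; first exact: add_continuous.
move=> j _ x; apply: (@cvgM _ _ _ (nbhs_filter x)); first exact: C.
exact: cvg_cst.
Qed.

Lemma quad_expand (R : realType) q (A : 'M[R]_q) (x z : 'rV[R]_q) t :
  A^T = A ->
  ((x + t *: z) *m A *m (x + t *: z)^T) 0 0 =
  (x *m A *m x^T) 0 0 + 2 * t * (x *m A *m z^T) 0 0 + t ^+ 2 * (z *m A *m z^T) 0 0.
Proof.
move=> symA; have E : (z *m A *m x^T) 0 0 = (x *m A *m z^T) 0 0.
  have -> : z *m A *m x^T = (x *m A *m z^T)^T by rewrite !trmx_mul trmxK symA mulmxA.
  by rewrite mxE.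
rewrite linearD linearZ /= !mulmxDl !mulmxDr -!scalemxAl -!scalemxAr.
have addE (M N : 'M[R]_1) : (M + N) 0 0 = M 0 0 + N 0 0 by rewrite mxE.
have scaleE a (M : 'M[R]_1) : (a *: M) 0 0 = a * M 0 0 by rewrite mxE.
rewrite !(addE, scaleE) E; ring.
Qed.

(** The minimum of the quadratic form on the unit sphere is attained, and it is
    attained at an eigenvector. *)
Lemma lambda_min_rayleigh (R : realType) q (A : 'M[R]_q) kappa (x : 'rV[R]_q) :
  A^T = A -> 0 < kappa -> kappa <= lambda_min A ->
  kappa * \sum_i x 0 i ^+ 2 <= (x *m A *m x^T) 0 0.
Proof.
move=> symA k0 kA.
pose f (x : 'rV[R]_q) := (x *m A *m x^T) 0 0.
pose n2 (x : 'rV[R]_q) := \sum_i x 0 i ^+ 2.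
have n2E y : n2 y = (y *m y^T) 0 0.
  by rewrite mxE; apply: eq_bigr => i _; rewrite mxE.
have n2Q y : n2 y = (y *m 1%:M *m y^T) 0 0 by rewrite mulmx1 n2E.
have n20 y : 0 <= n2 y by apply: sumr_ge0 => i _; rewrite sqr_ge0.
have n2z y : n2 y = 0 -> y = 0.
  move=> /eqP; rewrite psumr_eq0 => [/allP H|i _]; last exact: sqr_ge0.
  by apply/rowP => i; have := H i (mem_index_enum _); rewrite /= sqrf_eq0 mxE => /eqP.
have n2Z a y : n2 (a *: y) = a ^+ 2 * n2 y.
  by rewrite /n2 mulr_sumr; apply: eq_bigr => i _; rewrite mxE exprMn.
have fZ a y : f (a *: y) = a ^+ 2 * f y.
  by rewrite /f linearZ /= -!scalemxAl -scalemxAr !mxE mulrA expr2.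
have [->|x0] := eqVneq x 0.
  by rewrite mul0mx mul0mx mxE big1 ?mulr0// => i _; rewrite mxE expr0n.
have n2x : 0 < n2 x by rewrite lt_def n20 andbT; apply: contraNneq x0 => /n2z ->.
pose S := [set y : 'rV[R]_q | n2 y = 1].
have normed y : y != 0 -> exists2 a, a ^+ 2 * n2 y = 1 & a != 0.
  move=> y0; have n2y : 0 < n2 y.
    by rewrite lt_def n20 andbT; apply: contraNneq y0 => /n2z ->.
  exists (Num.sqrt (n2 y))^-1; last by rewrite invr_eq0 gt_eqF// sqrtr_gt0.
  by rewrite exprVn sqr_sqrtr// mulVf// gt_eqF.
have S0 : S !=set0.
  by have [a aE _] := normed _ x0; exists (a *: x); rewrite /S /= n2Z.
have cS : compact S.
  apply: bounded_closed_compact.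
    exists 1; split; [exact: num_real | move=> M /ltW M1 y Sy; apply: le_trans M1].
    apply: norm_le_coord => // j.
    rewrite -(@expr_le1 _ 2)// -normrX ger0_norm ?sqr_ge0//.
    rewrite -Sy /n2 (bigD1 j)//= lerDl; apply: sumr_ge0 => i _; exact: sqr_ge0.
  have := @continuous_closedP _ _ (fun x : 'rV[R]_q => (x *m 1%:M *m x^T) 0 0).
  case=> /(_ (@quad_continuous _ _ _)) H _.
  have := H _ (@closed_eq R 1); rewrite (_ : _ @^-1` _ = S)//.
  by apply/seteqP; split=> y; rewrite /S /= n2E mulmx1.
have [x1 Sx1 minf] : exists2 c, c \in S & forall t, t \in S -> f c <= f t.
  apply: EVT_min_rV => //; apply: continuous_subspaceT; exact: quad_continuous.
rewrite inE in Sx1; pose m := f x1.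
have fm y : m * n2 y <= f y.
  have [->|y0] := eqVneq y 0.
    by rewrite /f /n2 !mul0mx mxE big1 ?mulr0// => i _; rewrite mxE expr0n.
  have [a aE a0] := normed _ y0.
  have : m <= f (a *: y) by apply: minf; rewrite inE /S /= n2Z.
  rewrite fZ => H; have a20 : 0 < a ^+ 2 by rewrite exprn_even_gt0//= a0.
  by rewrite -(ler_pM2l a20) mulrCA aE mulr1.
suff km : kappa <= m by apply: le_trans (fm x); exact: ler_wpM2r (n20 x) _ _ km.
apply: (le_trans kA).
pose z := x1 *m A - m *: x1.
(* Perturb the minimizer along its own residual z: unless z = 0, a small step
   against z makes the Rayleigh quotient smaller. *)
have lin t : 0 <= 2 * t * n2 z + t ^+ 2 * (f z - m * n2 z).
  have := fm (x1 + t *: z).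
  have -> : n2 (x1 + t *: z) = n2 x1 + 2 * t * (x1 *m z^T) 0 0 + t ^+ 2 * n2 z.
    by rewrite !n2Q quad_expand ?trmx1// ?mulmx1.
  have -> : f (x1 + t *: z) = f x1 + 2 * t * (x1 *m A *m z^T) 0 0 + t ^+ 2 * f z.
    by rewrite /f quad_expand.
  have -> : n2 z = (x1 *m A *m z^T) 0 0 - m * (x1 *m z^T) 0 0.
    by rewrite n2E {1}/z mulmxBl -scalemxAl !mxE.
  rewrite (Sx1 : n2 x1 = 1) -/m; lra.
have z0 : z = 0.
  apply: n2z; apply/eqP; rewrite -[_ == _]negbK; apply/negP => n2z0.
  have n2p : 0 < n2 z by rewrite lt_def n2z0 n20.
  pose e := f z - m * n2 z.
  have e0 : 0 <= e by rewrite subr_ge0 fm.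
  have e1 : 0 < e + 1 by rewrite ltr_wpDl.
  have := lin (- (n2 z / (e + 1))); rewrite -/e.
  have -> : 2 * - (n2 z / (e + 1)) * n2 z + (- (n2 z / (e + 1))) ^+ 2 * e =
     - ((n2 z / (e + 1)) ^+ 2 * (e + 2)) by field; rewrite gt_eqF.
  by rewrite oppr_ge0 leNgt mulr_gt0 ?exprn_even_gt0//= ?gt_eqF ?divr_gt0// ltr_wpDl.
have em : eigenvalue A m.
  apply/eigenvalueP; exists x1; first by apply/eqP; rewrite -subr_eq0; apply/eqP.
  apply/eqP => x10; move: (Sx1 : n2 x1 = 1) => /eqP; rewrite x10 /n2 big1.
    by rewrite eq_sym oner_eq0.
  by move=> i _; rewrite mxE expr0n.
(* The infimum is 0 by convention for sets without one, which kappa > 0 excludes. *)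
apply: ge_inf => //; have [[]//|/inf_out E] := pselect (has_inf [set a | eigenvalue A a]).
by move: kA; rewrite /lambda_min E leNgt k0.
Qed.

Lemma sqr_sum_le (R : realType) q (a : 'I_q -> R) :
  (\sum_i a i) ^+ 2 <= q%:R * \sum_i a i ^+ 2.
Proof.
have sc (c : R) : \sum_(i < q) c = q%:R * c by rewrite sumr_const card_ord mulr_natl.
apply: (@le_trans _ _ (\sum_i \sum_j ((a i ^+ 2 + a j ^+ 2) / 2))).
  rewrite expr2 big_distrl /=; apply: ler_sum => i _; rewrite big_distrr /=.
  apply: ler_sum => j _; have := sqr_ge0 (a i - a j); lra.
under eq_bigr do rewrite -mulr_suml big_split /= sc.
rewrite -mulr_suml big_split /= sc -mulr_sumr; lra.
Qed.

(** The residual maker annihilates the columns of [Phi], so only [rho] matters.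
    The projection part of the contrast is the increment of the rows of [Phi]
    against the least-squares coefficients of [rho], which the lower bound on
    the Gram matrix keeps of the size of [rho], whatever the number of rows. *)
Lemma residual_pair_le (R : realType) N q (Phi : 'M[R]_(N, q)) (kappa B E M e : R)
    (rho : 'cV[R]_N) (w : 'cV[R]_q) (r r' : 'I_N) :
  0 < kappa -> kappa <= lambda_min (N%:R^-1 *: gram Phi) ->
  0 <= B -> 0 <= E -> 0 <= M ->
  (forall i c, `|Phi i c| <= B) ->
  (forall c, `|Phi r c - Phi r' c| <= E) ->
  (forall i, `|rho i 0| <= M) ->
  `|rho r 0 - rho r' 0| <= e ->
  `|((pair_diff R r r')^T *m residual_maker Phi *m (rho + Phi *m w)) 0 0| <=
    e + E * (q%:R * B * M / kappa).
Proof.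
move=> k0 kG B0 E0 M0 PhiB PhiE rhoM rhoe.
set G := gram Phi in kG *.
have N0 : 0 < N%:R :> R by rewrite ltr0n (leq_ltn_trans _ (ltn_ord r)).
have symG : G^T = G by rewrite /G /gram trmx_mul trmxK.
have coer (x : 'rV[R]_q) : kappa * N%:R * \sum_i x 0 i ^+ 2 <= (x *m G *m x^T) 0 0.
  have := @lambda_min_rayleigh _ _ _ _ x _ k0 kG; rewrite linearZ /= symG => /(_ erefl).
  rewrite -scalemxAr -scalemxAl mxE => H.
  by rewrite mulrAC -ler_pdivlMr// [X in _ <= X]mulrC.
have Gu : G \in unitmx.
  rewrite unitmxE unitfE; apply/det0P => -[v v0 vG].
  have := coer v; rewrite vG mul0mx mxE pmulr_rle0 ?mulr_gt0// => H.
  case/eqP: v0; apply/rowP => i; rewrite mxE; apply/eqP.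
  rewrite -sqrf_eq0 eq_le sqr_ge0 andbT; apply: le_trans H.
  by rewrite (bigD1 i)//= lerDl; apply: sumr_ge0 => j _; exact: sqr_ge0.
have RPhi : residual_maker Phi *m Phi = 0.
  rewrite /residual_maker -/G mulmxBl mul1mx -!mulmxA -[Phi^T *m Phi]/G.
  by rewrite mulVmx// mulmx1 subrr.
rewrite mulmxDr -!mulmxA [residual_maker Phi *m (Phi *m w)]mulmxA RPhi.
rewrite mul0mx mulmx0 addr0.
pose y := Phi^T *m rho; pose Z := invmx G *m y; pose S := \sum_c `|Z c 0|.
have S0 : 0 <= S by apply: sumr_ge0.
have yB c : `|y c 0| <= N%:R * (B * M).
  rewrite mxE; apply: le_trans (ler_norm_sum _ _ _) _.
  rewrite mulr_natl -[X in _ *+ X]card_ord -sumr_const; apply: ler_sum => i _.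
  by rewrite normrM mxE ler_pM.
(* Test the normal equations G Z = y against Z. *)
have quadZ : (Z^T *m G *m Z^T^T) 0 0 <= N%:R * (B * M) * S.
  rewrite trmxK -mulmxA mulKVmx// mxE mulr_sumr; apply: ler_sum => c _.
  by apply: le_trans (ler_norm _) _; rewrite normrM mxE mulrC ler_wpM2r.
have SB : S <= q%:R * B * M / kappa.
  have [Sp|] := ltP 0 S; last first.
    by move=> /le_trans; apply; rewrite !mulr_ge0// invr_ge0 ltW.
  have H1 := sqr_sum_le (fun c => `|Z c 0|); rewrite -/S in H1.
  have H2 : kappa * N%:R * \sum_c `|Z c 0| ^+ 2 <= N%:R * (B * M) * S.
    apply: le_trans quadZ; apply: le_trans (coer Z^T).
    by under [X in _ <= _ * X]eq_bigr do rewrite mxE -real_normK ?num_real//.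
  have H3 : kappa * \sum_c `|Z c 0| ^+ 2 <= B * M * S.
    by rewrite -(ler_pM2l N0) mulrA [N%:R * kappa]mulrC [X in _ <= X]mulrA.
  rewrite ler_pdivlMr// -(ler_pM2r Sp).
  apply: (@le_trans _ _ (kappa * (q%:R * \sum_c `|Z c 0| ^+ 2))).
    by rewrite mulrAC mulrC ler_wpM2l ?(ltW k0)// -expr2.
  by rewrite mulrCA -!mulrA ler_wpM2l// mulrA.
have -> : ((pair_diff R r r')^T *m (residual_maker Phi *m rho)) 0 0 =
    (rho r 0 - rho r' 0) - \sum_c (Phi r c - Phi r' c) * Z c 0.
  rewrite /residual_maker -/G mulmxBl mul1mx -!mulmxA -/y -/Z mulmxBr.
  have pd (v : 'cV[R]_N) : ((pair_diff R r r')^T *m v) 0 0 = v r 0 - v r' 0.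
    by rewrite /pair_diff linearB /= !trmx_delta mulmxBl -!rowE !mxE.
  have subE (U V : 'M[R]_1) : (U - V) 0 0 = U 0 0 - V 0 0 by rewrite !mxE.
  rewrite subE !pd; congr (_ - _); rewrite !mxE -sumrB; apply: eq_bigr => c _.
  by rewrite mulrBl.
apply: le_trans (ler_normB _ _) _; apply: lerD => //.
apply: (@le_trans _ _ (E * S)).
  apply: le_trans (ler_norm_sum _ _ _) _; rewrite mulr_sumr.
  by apply: ler_sum => c _; rewrite normrM ler_wpM2r.
exact: ler_wpM2l E0 _ _ SB.
Qed.

(** * Polynomials on the unit cube *)

Definition coeff_norm (R : realType) d (p : mpoly d R) : R :=
  \sum_(m <- msupp p) `|mcoeff m p|.

Lemma coeff_norm_ge0 (R : realType) d (p : mpoly d R) : 0 <= coeff_norm p.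
Proof. by apply: sumr_ge0 => m _. Qed.

Lemma meval_le_coeff_norm (R : realType) d (p : mpoly d R) (u : 'rV[R]_d) :
  unit_cube u -> `|meval (fun j => u 0 j) p| <= coeff_norm p.
Proof.
move=> u01; rewrite mevalE; apply: le_trans (ler_norm_sum _ _ _) _.
apply: ler_sum => m _; rewrite normrM ler_piMr// normr_prod.
apply: prodr_ile1 => j; have /andP[u0 u1] := u01 j.
by rewrite normrX ger0_norm// exprn_ge0// exprn_ile1.
Qed.

Lemma meval_lipschitz (R : realType) d (p : mpoly d R) (u v : 'rV[R]_d) :
  unit_cube u -> unit_cube v ->
  `|meval (fun j => u 0 j) p - meval (fun j => v 0 j) p| <=
    (\sum_i coeff_norm (mderiv i p)) * \sum_j `|u 0 j - v 0 j|.
Proof.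
move=> u01 v01.
have E (q : mpoly d R) (z : 'rV[R]_d) : meval (fun j => z 0 j) q = centered_eval 0 q z.
  by apply: meval_eq => j; rewrite mxE subr0.
have box (z : 'rV[R]_d) :
    (forall j, (0 : 'rV[R]_d) 0 j <= z 0 j <= (const_mx 1 : 'rV[R]_d) 0 j) <->
    unit_cube z.
  by split=> H j; have := H j; rewrite !mxE.
rewrite !E; apply: (@box_lipschitz _ _ _ 0 (const_mx 1)); [|exact/box..].
move=> z /box z01 i; have D := is_derive_centered_eval 0 p z i.
split; first by case: D.
rewrite partial_centered_eval -E; apply: le_trans (meval_le_coeff_norm _ z01) _.
by rewrite (bigD1 i)//= lerDl sumr_ge0// => j _; exact: coeff_norm_ge0.
Qed.

(** Passing to the coordinates of a cell does not raise the degree. *)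
Lemma meval_rescale (R : realType) d l (a : 'I_d -> R) (p : mpoly d R) :
  (mmeasure (@mdeg d) p <= l)%N ->
  exists2 p', (mmeasure (@mdeg d) p' <= l)%N &
    forall u, meval u p' = meval (fun j => a j * u j) p.
Proof.
move=> pl; exists (\sum_(m <- msupp p) (mcoeff m p * \prod_j a j ^+ m j) *: mpolyX R m).
  apply: leq_trans (mmeasure_sum _ _ _ _) _; apply/bigmax_leqP_seq => m mp _.
  apply: leq_trans (mmeasureZ_le _ _ _) _; rewrite mmeasureX.
  exact: leq_trans (mmeasure_mnm_lt _ mp) pl.
move=> u; rewrite raddf_sum mevalE; apply: eq_bigr => m _.
rewrite /= mevalZ mevalX -mulrA -big_split /=; congr (_ * _).
by apply: eq_bigr => j _; rewrite exprMn.
Qed.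

(** * Geometry of the cells *)

(** As the splitting exponents differ by at most one, [r <= d * (s j + 1)]; this
    is where the factor 2 comes from. *)
Lemma cell_side_le (R : realType) d (rnd : R -> int) (lambda0 : R) n s (j : 'I_d) :
  balanced_split (resolution rnd lambda0 n) s ->
  2 ^- s j <= 2 * cell_size d rnd lambda0 n.
Proof.
move=> [rs bal]; have d0 : 0 < d%:R :> R by rewrite ltr0n; case: (d) j => [[]|].
rewrite /cell_size /cell_number natrX -powR_mulrn// -powRrM.
rewrite -[X in X * _]powRr1// -powRD; last by apply/implyP; rewrite pnatr_eq0.
rewrite -powR_mulrn// -powRN ler_powR ?ler1n//.
have : (resolution rnd lambda0 n <= d * (s j).+1)%N.
  by rewrite -rs -[X in (_ <= X * _)%N]card_ord -sum_nat_const; apply: leq_sum.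
rewrite -(ler_nat R) natrM -natr1 => H.
have {}H : (resolution rnd lambda0 n)%:R / d%:R <= (s j)%:R + 1 :> R.
  by rewrite ler_pdivrMr// mulrC.
by rewrite mulrN; lra.
Qed.

Lemma cell_coordE (R : realType) d (s : 'I_d -> nat) (Q : cell_index s)
    (x : 'rV[R]_d) j :
  x 0 j = cell_corner R Q 0 j + 2 ^- s j * cell_coord Q x 0 j.
Proof.
have Au : cell_scale R s \in unitmx.
  rewrite unitmxE det_diag unitfE prodf_seq_neq0; apply/allP => i _ /=.
  by rewrite mxE invr_eq0 expf_neq0.
have E : cell_coord Q x *m cell_scale R s = x - cell_corner R Q by rewrite mulmxKV.
move/rowP/(_ j): E; rewrite mul_mx_diag mxE [X in _ * X]mxE => E.
have -> : x 0 j = cell_corner R Q 0 j + (x - cell_corner R Q) 0 j.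
  by rewrite !mxE addrCA subrr addr0.
by rewrite mulrC -E.
Qed.

Lemma cell_corner_bound (R : realType) d (s : 'I_d -> nat) (Q : cell_index s) j :
  0 <= cell_corner R Q 0 j /\ cell_corner R Q 0 j + 2 ^- s j <= 1.
Proof.
have p0 : 0 < 2 ^+ s j :> R by rewrite exprn_gt0.
rewrite mxE; split; first by rewrite divr_ge0// ltW.
by rewrite -[X in _ + X]mul1r -mulrDl ler_pdivrMr// mul1r natr1 -natrX ler_nat.
Qed.

Lemma in_cell_box (R : realType) d side (s : 'I_d -> nat) (Q : cell_index s)
    (x : 'rV[R]_d) :
  in_cell side Q x ->
  forall j, cell_corner R Q 0 j <= x 0 j <= cell_corner R Q 0 j + 2 ^- s j.
Proof.
move=> /forallP xQ j; have := xQ j.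
have p0 : 2 ^+ s j != 0 :> R by rewrite expf_neq0.
have -> : cell_corner R Q 0 j + 2 ^- s j = (Q j).+1%:R / 2 ^+ s j.
  by rewrite mxE -[X in _ + X]mul1r -mulrDl natr1.
rewrite mxE /cell_interval itv_boundlr => /andP[xl xr]; apply/andP; split.
  case: eqP xl => [->|_]; first by rewrite mul0r bnd_simp.
  by case: (side j); rewrite bnd_simp // => /ltW.
case: eqP xr => [->|_]; first by rewrite natrX divff// bnd_simp.
by case: (side j); rewrite bnd_simp // => /ltW.
Qed.

(** * The contrast of a close pair *)

Theorem lemma3p5 (R : realType) (d : nat) (U : set 'rV[R]_d) (L : R)
    (beta kappa v0 lambda0 : R) (rnd : R -> int) (s : nat -> 'I_d -> nat)
    (side : 'I_d -> bool)
    (psi : 'I_('C(d + holder_order beta, holder_order beta)) -> mpoly d R) :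
  open U -> @unit_cube R d `<=` U -> 1 <= L ->
  1 < beta -> 4 * beta < d%:R ->
  0 < kappa -> 0 < v0 -> 0 < lambda0 ->
  rounds_to_nearest rnd ->
  (forall n, (0 < n)%N -> balanced_split (resolution rnd lambda0 n) (s n)) ->
  poly_basis (holder_order beta) psi ->
  exists C : R,
    forall (t : R) (n : nat) (f : 'rV[R]_d -> R) (X : 'I_n -> 'rV[R]_d),
    0 < t <= 1 ->
    (0 < n)%N ->
    (exists2 g, holder_ball U beta L g &
       forall x, unit_cube x -> f x = g x) ->
    (forall i, unit_cube (X i)) ->
    forall Q : cell_index (s n),
    let IQ := cell_points side Q X in
    let Uc i := cell_coord Q (X i) in
    let PhiQ := basis_matrix psi IQ Uc in
    let GQ := gram PhiQ in
    let RQ := residual_maker PhiQ in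
    let fQ := \col_(r < #|IQ|) f (X (enum_val r)) in
    kappa <= lambda_min (#|IQ|%:R^-1 *: GQ) ->
    forall r r' : 'I_#|IQ|, r != r' ->
    let de := pair_diff R r r' in
    let ve := (de^T *m RQ *m de) 0 0 in
    `|Uc (enum_val r) - Uc (enum_val r')| <= t ->
    v0 <= ve ->
    `|(de^T *m RQ *m fQ) 0 0 / Num.sqrt ve|
      <= C * cell_size d rnd lambda0 n `^ beta * t.
Proof.
move=> oU cubeU L1 b1 _ k0 v00 _ _ bal [psi_deg psi_span].
have L0 : 0 <= L by apply: le_trans L1.
pose q := 'C(d + holder_order beta, holder_order beta).
pose B := \sum_c coeff_norm (psi c).
pose D := \sum_c \sum_i coeff_norm (mderiv i (psi c)).
have B0 : 0 <= B by apply: sumr_ge0 => c _; exact: coeff_norm_ge0.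
have cD0 c : 0 <= \sum_i coeff_norm (mderiv i (psi c)).
  by apply: sumr_ge0 => i _; exact: coeff_norm_ge0.
have D0 : 0 <= D by apply: sumr_ge0 => c _; exact: cD0.
pose K := 1 + D * d%:R * (q%:R * B / kappa).
have K0 : 0 <= K by rewrite addr_ge0// !mulr_ge0// invr_ge0 ltW.
exists (L * (2 * d%:R) `^ beta * K / Num.sqrt v0).
move=> t n f X /andP[t0 _] n0 [g gH fg] X01 Q IQ Uc PhiQ GQ RQ fQ kG r r' _ de ve Ut vev.
set H := cell_size d rnd lambda0 n.
have H0 : 0 <= H by exact: powR_ge0.
have h0 : 0 <= 2 * H by rewrite mulr_ge0.
pose b := cell_corner R Q; pose a j : R := 2 ^- s n j.
have a0 j : 0 < a j by rewrite invr_gt0 exprn_gt0.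
pose c : 'rV[R]_d := \row_j (b 0 j + a j).
have bch j : b 0 j <= c 0 j <= b 0 j + 2 * H.
  by have := cell_side_le j (bal n n0); have := a0 j; rewrite [c 0 j]mxE -/H -/(a j); lra.
have BU (x : 'rV[R]_d) : (forall j, b 0 j <= x 0 j <= c 0 j) -> U x.
  move=> xB; apply: cubeU => j; have := xB j; rewrite [c 0 j]mxE.
  by have := cell_corner_bound R Q j; rewrite -/b -/(a j); lra.
have [] := holder_taylor_box b1 L0 h0 oU gH BU bch.
set M := L * _; set rem := taylor_rem _ _ _ _ => remM remt.
have M0 : 0 <= M by rewrite mulr_ge0// powR_ge0.
pose x (i : 'I_#|IQ|) : 'rV[R]_d := X (enum_val i).
pose u (i : 'I_#|IQ|) : 'rV[R]_d := Uc (enum_val i).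
have xB (i : 'I_#|IQ|) j : b 0 j <= x i 0 j <= c 0 j.
  have := enum_valP i; rewrite inE => /in_cell_box/(_ j).
  by rewrite [c 0 j]mxE.
have xu i j : x i 0 j = b 0 j + a j * u i 0 j by exact: cell_coordE.
have u01 i : unit_cube (u i).
  move=> j; have := xB i j; rewrite xu [c 0 j]mxE => /andP[].
  rewrite lerDl lerD2l -[X in _ -> _ * _ <= X -> _]mulr1.
  by rewrite pmulr_rge0// ler_pM2l// => -> ->.
have uu j : `|u r 0 j - u r' 0 j| <= t.
  by apply: le_trans Ut; have := coord_le_norm (u r - u r') j; rewrite !mxE.
(* In cell coordinates, the Taylor polynomial is in the span of [psi]. *)
have [p' p'_deg p'E] := meval_rescale a (taylor_size (holder_order beta) g b).
have [w [wE _]] := psi_span p' p'_deg.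
pose rho : 'cV[R]_#|IQ| := \col_i rem (x i).
have fE : fQ = rho + PhiQ *m w^T.
  apply/colP => i; rewrite !mxE fg//.
  rewrite -[g _](subrK (centered_eval b (taylor (holder_order beta) g b) (x i))).
  congr (_ + _); rewrite /centered_eval.
  rewrite (meval_eq (v2 := fun j => a j * u i 0 j)); last first.
    by move=> j; rewrite xu addrAC subrr add0r.
  rewrite -(p'E (fun j => u i 0 j)) wE raddf_sum; apply: eq_bigr => k _.
  by rewrite /= mevalZ !mxE mulrC.
have main : `|(de^T *m RQ *m fQ) 0 0| <= M * K * t.
  rewrite fE; apply: le_trans (residual_pair_le (B := B) (E := D * (d%:R * t)) (M := M)
    (e := M * t) _ k0 kG _ _ _ _ _ _ _) _ => //.
  - by rewrite !mulr_ge0// ltW.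
  - move=> i k; rewrite mxE; apply: le_trans (meval_le_coeff_norm _ (u01 i)) _.
    rewrite /B (bigD1 k)//= lerDl sumr_ge0// => m _; exact: coeff_norm_ge0.
  - move=> k; rewrite !mxE.
    apply: le_trans (meval_lipschitz _ (u01 r) (u01 r')) _.
    apply: ler_pM => //; first exact: sumr_ge0.
      by rewrite /D (bigD1 k)//= lerDl sumr_ge0.
    rewrite mulr_natl -[X in _ *+ X]card_ord -sumr_const.
    by apply: ler_sum => j _; exact: uu.
  - by move=> i; rewrite mxE; exact: remM.
  - rewrite !mxE; apply: remt => // j; rewrite !xu.
    have -> : b 0 j + a j * u r 0 j - (b 0 j + a j * u r' 0 j) =
        a j * (u r 0 j - u r' 0 j) by ring.
    rewrite normrM gtr0_norm//; apply: ler_pM => //; first exact: ltW.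
    exact: cell_side_le (bal n n0).
  - by rewrite le_eqVlt; apply/orP; left; apply/eqP; rewrite /K /q; ring.
have sv0 : 0 < Num.sqrt v0 by rewrite sqrtr_gt0.
have sve : Num.sqrt v0 <= Num.sqrt ve by rewrite ler_wsqrtr.
have sve0 : 0 < Num.sqrt ve by exact: lt_le_trans sve.
rewrite normrM normfV (gtr0_norm sve0).
apply: (@le_trans _ _ (M * K * t / Num.sqrt v0)).
  by apply: ler_pM => //; rewrite lef_pV2.
have -> : M = L * ((2 * d%:R) `^ beta * H `^ beta).
  by rewrite -powRM ?mulr_ge0// /M mulrCA mulrA.
by rewrite le_eqVlt; apply/orP; left; apply/eqP; ring.
Qed.
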